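(* For every $n\in\mathbb{N}$ there exists $\delta=\delta(n)>0$, and for every $\lambda>0$ a constant $C_\lambda>0$ depending only on $\lambda$ and $n$, such that the following holds. Let $d>n$, $S\subset\mathbb{R}^d$, $\varepsilon\in(0,1/2)$, and let $\alpha_i,\beta_i,\mathsf{b}_i$ ($i\in\mathbb{Z}$) be the numbers associated to $S$, $n$, $\varepsilon$ as defined in the context. Suppose that there is $\bar i\in\mathbb{N}$ with $2^{-\bar i}<\varepsilon$ such that $\alpha_i\le\delta$ for every $i\ge\bar i-2$. Then $$\sum_{i\ge\bar i}\mathsf{b}_i^{\lambda}\le C_\lambda\sum_{i\ge\bar i-2}\beta_i^{2\lambda}\qquad\text{for every }\lambda>0.$$
   Context: $\mathbb{N}=\{1,2,\dots\}$. $B_r(x)$ denotes the open Euclidean ball in $\mathbb{R}^d$, and $B^{\mathbb{R}^n}_r(0)$ the open Euclidean ball in $\mathbb{R}^n$. $\mathsf{d}_H$ is the Hausdorff distance between subsets of $\mathbb{R}^d$, and $\mathsf{d}(y,\Gamma)$ is the Euclidean distance from a point $y$ to an affine plane $\Gamma$. For $\delta>0$, a map $f:X_1\to X_2$ between metric spaces $(X_1,\mathsf{d}_1),(X_2,\mathsf{d}_2)$ (not assumed continuous) is a $\delta$-isometry if $|\mathsf{d}_2(f(x),f(y))-\mathsf{d}_1(x,y)|<\delta$ for all $x,y\in X_1$. For $S\subset\mathbb{R}^d$, $n<d$, $x\in S$ and $r>0$ set $$\alpha(x,r):=r^{-1}\inf_{\Gamma}\mathsf{d}_H(S\cap B_r(x),\Gamma\cap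 B_r(x)),\qquad \beta(x,r):=r^{-1}\inf_{\Gamma}\sup_{y\in S\cap B_r(x)}\mathsf{d}(y,\Gamma),$$ where both infima are over all $n$-dimensional affine planes $\Gamma\subset\mathbb{R}^d$ containing $x$, and $$\mathsf{b}(x,r):=r^{-1}\inf\{\delta>0:\ \text{there exists a }\delta\text{-isometry } f:S\cap B_r(x)\to B^{\mathbb{R}^n}_r(0)\},$$ where both sets are endowed with the Euclidean distance. For $\varepsilon\in(0,1/2)$ and $i\in\mathbb{Z}$ set $$\alpha_i:=\sup_{x\in S\cap B_1(0)}\alpha(x,2^{-i}),\quad \beta_i:=\sup_{x\in S\cap B_1(0)}\beta(x,2^{-i}),\quad \mathsf{b}_i:=\sup_{x\in S\cap B_{1-\varepsilon}(0)}\mathsf{b}(x,2^{-i}),$$ with the supremum over the empty set understood to be $0$. *)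

(* Defs.v *)
From HB Require Import structures.
From mathcomp Require Import all_boot all_order all_algebra.
From mathcomp Require Import all_classical all_reals all_analysis.

Set Implicit Arguments.
Unset Strict Implicit.
Unset Printing Implicit Defensive.

Import Order.TTheory GRing.Theory Num.Theory.

Local Open Scope classical_set_scope.
Local Open Scope ring_scope.

(* [R]^d is ['rV[R]_d].  The norm and [ball] that MathComp-Analysis attaches
   to row vectors are those of the sup norm, hence the Euclidean versions. *)

Definition eucl_dist (R : realType) (d : nat) (x y : 'rV[R]_d) : R :=
  Num.sqrt (\sum_(i < d) (x 0 i - y 0 i) ^+ 2).

Definition eucl_ball (R : realType) (d : nat) (x : 'rV[R]_d) (r : R) :
    set 'rV[R]_d :=
  [set y | eucl_dist x y < r].

Definition dist_to (R : realType) (d : nat) (A : set 'rV[R]_d)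
    (y : 'rV[R]_d) : \bar R :=
  ereal_inf [set (eucl_dist y z)%:E | z in A].

Definition hausdorff_dist (R : realType) (d : nat) (A B : set 'rV[R]_d) :
    \bar R :=
  Order.max (ereal_sup [set dist_to B a | a in A])
            (ereal_sup [set dist_to A b | b in B]).

Definition affine_plane (R : realType) (d n : nat) (G : set 'rV[R]_d) : Prop :=
  exists (p : 'rV[R]_d) (V : {vspace 'rV[R]_d}),
    (\dim V = n)%N /\ G = [set p + v | v in [set v | v \in V]].

(* The metric spaces are subsets [A], [B] of Euclidean spaces; a map [A -> B]
   is a total function sending [A] into [B], whose values off [A] are
   irrelevant. *)
Definition delta_isometry (R : realType) (d n : nat) (delta : R)
    (A : set 'rV[R]_d) (B : set 'rV[R]_n) (f : 'rV[R]_d -> 'rV[R]_n) : Prop :=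
  (forall x, A x -> B (f x)) /\
  (forall x y, A x -> A y ->
     `|eucl_dist (f x) (f y) - eucl_dist x y| < delta).

Definition alpha (R : realType) (d n : nat) (S : set 'rV[R]_d)
    (x : 'rV[R]_d) (r : R) : \bar R :=
  ((r^-1)%:E *
   ereal_inf [set hausdorff_dist (S `&` eucl_ball x r) (G `&` eucl_ball x r)
             | G in [set G | affine_plane n G /\ G x]])%E.

Definition beta (R : realType) (d n : nat) (S : set 'rV[R]_d)
    (x : 'rV[R]_d) (r : R) : \bar R :=
  ((r^-1)%:E *
   ereal_inf [set ereal_sup [set dist_to G y | y in S `&` eucl_ball x r]
             | G in [set G | affine_plane n G /\ G x]])%E.

Definition bnum (R : realType) (d n : nat) (S : set 'rV[R]_d)
    (x : 'rV[R]_d) (r : R) : \bar R :=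
  ((r^-1)%:E *
   ereal_inf [set delta%:E | delta in
     [set delta : R | (0 < delta)%R /\
        exists f : 'rV[R]_d -> 'rV[R]_n,
          delta_isometry delta (S `&` eucl_ball x r)
            (eucl_ball (0 : 'rV[R]_n) r) f]])%E.

(* Supremum of nonnegative quantities; adjoining [0] changes nothing but the
   supremum over the empty set, which is thereby [0] instead of [-oo]. *)
Definition sup_ge0 (R : realType) (A : set (\bar R)) : \bar R :=
  ereal_sup (0%E |` A).

Definition alpha_ (R : realType) (d n : nat) (S : set 'rV[R]_d) (i : int) :
    \bar R :=
  sup_ge0 [set alpha n S x (2 ^ (- i)) | x in S `&` eucl_ball 0 1].

Definition beta_ (R : realType) (d n : nat) (S : set 'rV[R]_d) (i : int) :
    \bar R :=
  sup_ge0 [set beta n S x (2 ^ (- i)) | x in S `&` eucl_ball 0 1].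

Definition bnum_ (R : realType) (d n : nat) (S : set 'rV[R]_d) (eps : R)
    (i : int) : \bar R :=
  sup_ge0 [set bnum n S x (2 ^ (- i)) | x in S `&` eucl_ball 0 (1 - eps)].

(* Main.v *)
Require Import Defs.
From HB Require Import structures.
From mathcomp Require Import all_boot all_order all_algebra.
From mathcomp Require Import all_classical all_reals all_analysis.
From mathcomp Require Import ring lra zify.

Set Implicit Arguments.
Unset Strict Implicit.
Unset Printing Implicit Defensive.

Import Order.TTheory GRing.Theory Num.Theory.

Local Open Scope classical_set_scope.
Local Open Scope ring_scope.

(** Fix [x] and [i], let [x + V] be a nearly optimal plane for [beta] at [x] and
    scale [2^(2-i)], and take for [f] the orthogonal projection of [y - x] to
    [V], identified with [R^n] by an orthonormal basis.  For [v = z - y] the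
    distortion [|v| - |pi v|] is at most [|v - pi v|^2 / |v|], which is where
    the square of [beta] comes from.  If [|v| ~ 2^-j], then [v] is almost
    tangent to the plane of [y] at scale [2^-j], and this plane is tilted with
    respect to [V] by at most a multiple of the sum of the [beta_k] with
    [i - 2 <= k <= j]: small [alpha] provides [n] points of [S] close to an
    orthogonal frame, so that two planes close to [S] at comparable scales make
    a small angle.  If [beta_k <= M (4/3)^(k-i+2)] for all [k], the tilt is a
    multiple of [M (4/3)^(j-i+2)], and as [(4/3)^2 < 2] the distortion is at
    most a multiple of [M^2 2^-i].  Hence [b_i] is at most a multiple of
    [sup_k (3/4)^(2(k-i+2)) beta_k^2]; bounding the power [lambda] of the
    supremum by a sum and exchanging sums gives the theorem. *)

(** * Euclidean geometry of row vectors *)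

Section Euclidean.
Context {R : realType}.

Definition dot d (u v : 'rV[R]_d) : R := (u *m v^T) 0 0.
Definition enorm d (v : 'rV[R]_d) : R := Num.sqrt (dot v v).

Lemma dotE d (u v : 'rV[R]_d) : dot u v = \sum_i u 0 i * v 0 i.
Proof. by rewrite /dot mxE; apply: eq_bigr => i _; rewrite mxE. Qed.

Lemma dotC d (u v : 'rV[R]_d) : dot u v = dot v u.
Proof. by rewrite !dotE; apply: eq_bigr => i _; rewrite mulrC. Qed.

Lemma dotDl d (u v w : 'rV[R]_d) : dot (u + v) w = dot u w + dot v w.
Proof. by rewrite /dot mulmxDl mxE. Qed.

Lemma dotZl d a (u w : 'rV[R]_d) : dot (a *: u) w = a * dot u w.
Proof. by rewrite /dot -scalemxAl mxE. Qed.

Lemma dotDr d (u v w : 'rV[R]_d) : dot w (u + v) = dot w u + dot w v.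
Proof. by rewrite dotC dotDl !(dotC w). Qed.

Lemma dotZr d a (u w : 'rV[R]_d) : dot w (a *: u) = a * dot w u.
Proof. by rewrite dotC dotZl (dotC w). Qed.

Lemma dotNl d (u w : 'rV[R]_d) : dot (- u) w = - dot u w.
Proof. by rewrite -scaleN1r dotZl mulN1r. Qed.

Lemma dotNr d (u w : 'rV[R]_d) : dot w (- u) = - dot w u.
Proof. by rewrite -scaleN1r dotZr mulN1r. Qed.

Lemma dot_ge0 d (u : 'rV[R]_d) : 0 <= dot u u.
Proof. by rewrite dotE sumr_ge0// => i _; rewrite -expr2 sqr_ge0. Qed.

Lemma dot_eq0 d (u : 'rV[R]_d) : dot u u = 0 -> u = 0.
Proof.
rewrite dotE => /eqP; rewrite psumr_eq0; last by move=> i _; rewrite -expr2 sqr_ge0.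
move=> /allP u0; apply/rowP => i; rewrite mxE.
by have := u0 i (mem_index_enum _); rewrite -expr2 sqrf_eq0 => /eqP.
Qed.

Lemma dotD_orthogonal d (u v : 'rV[R]_d) :
  dot u v = 0 -> dot (u + v) (u + v) = dot u u + dot v v.
Proof. by move=> uv; rewrite !(dotDl, dotDr) (dotC v u) uv addr0 add0r. Qed.

Lemma enorm_ge0 d (u : 'rV[R]_d) : 0 <= enorm u.
Proof. exact: sqrtr_ge0. Qed.

Lemma sqr_enorm d (u : 'rV[R]_d) : enorm u ^+ 2 = dot u u.
Proof. by rewrite sqr_sqrtr// dot_ge0. Qed.

Lemma enorm0 d : enorm (0 : 'rV[R]_d) = 0.
Proof. by rewrite /enorm /dot mul0mx mxE sqrtr0. Qed.

Lemma enorm_eq0 d (u : 'rV[R]_d) : enorm u = 0 -> u = 0.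
Proof. by move=> u0; apply: dot_eq0; rewrite -sqr_enorm u0 expr0n. Qed.

Lemma enormN d (u : 'rV[R]_d) : enorm (- u) = enorm u.
Proof. by rewrite /enorm dotNl dotNr opprK. Qed.

Lemma enormZ d a (u : 'rV[R]_d) : enorm (a *: u) = `|a| * enorm u.
Proof. by rewrite /enorm dotZl dotZr mulrA -expr2 sqrtrM ?sqr_ge0// sqrtr_sqr. Qed.

Lemma eucl_distE d (x y : 'rV[R]_d) : eucl_dist x y = enorm (x - y).
Proof.
rewrite /eucl_dist /enorm dotE; congr Num.sqrt.
by apply: eq_bigr => i _; rewrite !mxE expr2.
Qed.

Lemma cauchy_schwarz d (u v : 'rV[R]_d) : dot u v <= enorm u * enorm v.
Proof.
have [->|v0] := eqVneq v 0.
  by rewrite enorm0 mulr0 dotC /dot mul0mx mxE.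
have vv : 0 < dot v v.
  by rewrite lt_neqAle dot_ge0 andbT eq_sym; apply: contra_neq v0; exact: dot_eq0.
have [uv|uv] := leP (dot u v) 0.
  by rewrite (le_trans uv)// mulr_ge0// enorm_ge0.
rewrite -(@ler_pXn2r _ 2)// ?nnegrE ?mulr_ge0 ?enorm_ge0 ?(ltW uv)//.
rewrite exprMn !sqr_enorm.
have := dot_ge0 (dot v v *: u - dot u v *: v).
rewrite !(dotDl, dotDr, dotNl, dotNr, dotZl, dotZr) (dotC v u) => h.
rewrite -subr_ge0 -(pmulr_rge0 _ vv).
apply: le_trans h _.
by rewrite le_eqVlt; apply/orP; left; apply/eqP; ring.
Qed.

Lemma ler_enormD d (u v : 'rV[R]_d) : enorm (u + v) <= enorm u + enorm v.
Proof.
rewrite -(@ler_pXn2r _ 2)// ?nnegrE ?addr_ge0 ?enorm_ge0//.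
rewrite sqrrD !sqr_enorm !(dotDl, dotDr) (dotC v u).
by have := cauchy_schwarz u v; lra.
Qed.

Lemma ler_enormB d (u v : 'rV[R]_d) : enorm u - enorm v <= enorm (u - v).
Proof. by have := ler_enormD (u - v) v; rewrite subrK; lra. Qed.

Lemma ler_enorm_coord d (c : 'rV[R]_d) a : `|c 0 a| <= enorm c.
Proof.
rewrite -sqrtr_sqr ler_wsqrtr// dotE (bigD1 a)//= expr2 lerDl sumr_ge0//.
by move=> i _; rewrite -expr2 sqr_ge0.
Qed.

(** Each coordinate of [c] is bounded by its whole norm, at the cost of the factor [n] that the tilt
    bounds carry. *)
Lemma ler_enorm_mulmx n d (c : 'rV[R]_n) (W : 'M[R]_(n, d)) k :
  (forall a, enorm (row a W) <= k) -> enorm (c *m W) <= n%:R * k * enorm c.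
Proof.
move=> Wk.
have -> : c *m W = \sum_a c 0 a *: row a W.
  by rewrite mulmx_sum_row.
have: enorm (\sum_a c 0 a *: row a W) <=
     \sum_(a < n) (`|c 0 a| * enorm (row a W)).
  elim/big_ind2: _ => [|x1 x2 y1 y2 h1 h2|a _]; first by rewrite enorm0.
    by apply: le_trans (ler_enormD _ _) _; exact: lerD.
  by rewrite enormZ.
move=> /le_trans; apply.
have -> : n%:R * k * enorm c = \sum_(a < n) enorm c * k.
  by rewrite sumr_const card_ord -mulr_natl; ring.
by apply: ler_sum => a _; rewrite ler_pM// ?enorm_ge0// ler_enorm_coord.
Qed.

(* For orthonormal [E], the component of [v] orthogonal to the row space. *)
Definition res n d (E : 'M[R]_(n, d)) (v : 'rV[R]_d) := v - v *m E^T *m E.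

(** * Orthogonal projection to a row space *)

Section Orthonormal.
Variables (n d : nat) (E : 'M[R]_(n, d)).
Hypothesis EE : E *m E^T = 1%:M.

Lemma enorm_orthonormal (c : 'rV[R]_n) : enorm (c *m E) = enorm c.
Proof. by rewrite /enorm /dot trmx_mul mulmxA -(mulmxA c) EE mulmx1. Qed.

Lemma dot_res (v : 'rV[R]_d) :
  dot v v = dot (v *m E^T) (v *m E^T) + dot (res E v) (res E v).
Proof.
have vE0 : res E v *m E^T = 0.
  by rewrite /res mulmxBl -!mulmxA EE mulmx1 subrr.
have d0 : dot (res E v) (v *m E^T *m E) = 0.
  by rewrite /dot trmx_mul mulmxA vE0 mul0mx mxE.
have -> : dot v v = dot (res E v + v *m E^T *m E) (res E v + v *m E^T *m E).
  by rewrite /res subrK.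
by rewrite dotD_orthogonal// addrC -[in LHS]sqr_enorm enorm_orthonormal sqr_enorm.
Qed.

Lemma res_mulmx (c : 'rV[R]_n) : res E (c *m E) = 0.
Proof. by rewrite /res -!mulmxA [E *m (_ *m _)]mulmxA EE mul1mx subrr. Qed.

Lemma resD (u v : 'rV[R]_d) : res E (u + v) = res E u + res E v.
Proof. by rewrite /res !mulmxDl opprD addrACA. Qed.

Lemma resZ a (v : 'rV[R]_d) : res E (a *: v) = a *: res E v.
Proof. by rewrite /res -!scalemxAl scalerBr. Qed.

Lemma resB (u v : 'rV[R]_d) : res E (u - v) = res E u - res E v.
Proof. by rewrite resD -scaleN1r resZ scaleN1r. Qed.

Lemma ler_enorm_res (v : 'rV[R]_d) : enorm (res E v) <= enorm v.
Proof. by rewrite ler_wsqrtr// (dot_res v) lerDr dot_ge0. Qed.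

Lemma ler_enorm_proj (v : 'rV[R]_d) : enorm (v *m E^T) <= enorm v.
Proof. by rewrite ler_wsqrtr// (dot_res v) lerDl dot_ge0. Qed.

(** [res E] kills the row space and does not increase norms; this turns distances to a plane into
    bounds on residuals. *)
Lemma ler_res_dist (v : 'rV[R]_d) (c : 'rV[R]_n) :
  enorm (res E v) <= enorm (v - c *m E).
Proof. by have := ler_enorm_res (v - c *m E); rewrite resB res_mulmx subr0. Qed.

(** Pythagoras makes $|v|^2-|\pi v|^2$ the squared residual, and its factor $|v|+|\pi v|$ is at
    least $|v|$. *)
Lemma proj_defect (v : 'rV[R]_d) :
  enorm v * (enorm v - enorm (v *m E^T)) <= enorm (res E v) ^+ 2.
Proof.
have := dot_res v; rewrite -!sqr_enorm => h.
have := ler_enorm_proj v; have := enorm_ge0 v; have := enorm_ge0 (v *m E^T).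
by nra.
Qed.

End Orthonormal.

(** Gram-Schmidt: the residual of a new basis vector [x] against the frame [E'] of the others is
    normalized and put on top of [E']. *)
Lemma orthonormal_basis n d (V : {vspace 'rV[R]_d}) : (\dim V = n)%N ->
  exists E : 'M[R]_(n, d), E *m E^T = 1%:M /\
    forall v, v \in V <-> exists c, v = c *m E.
Proof.
elim: n V => [|n IH] V dimV.
  exists 0; split; first by apply/matrixP; case.
  move=> v; have /eqP -> : V == 0%VS by rewrite -dimv_eq0 dimV.
  rewrite memv0; split => [/eqP ->|[c ->]]; first by exists 0; rewrite mulmx0.
  by rewrite mulmx0.
have [B BV sB] : exists2 B : seq 'rV[R]_d, basis_of V B & size B = n.+1.
  by exists (vbasis V); [exact: vbasisP | rewrite size_tuple].
case: B BV sB => [//|x X] /andP[/eqP VX fX] [sX].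
move: fX; rewrite free_cons => /andP[xX fX].
have [E' [EE' E'V]] := IH <<X>>%VS ltac:(by move/eqP: fX => ->).
set w := res E' x.
have w0 : w != 0.
  apply: contraNneq xX => w0; apply/E'V; exists (x *m E'^T).
  by apply/eqP; rewrite -subr_eq0 -/(res E' x) -/w w0.
have nw0 : enorm w != 0 by apply: contra_neq w0; exact: enorm_eq0.
have wE' : w *m E'^T = 0 by rewrite /w /res mulmxBl -!mulmxA EE' mulmx1 subrr.
pose u := (enorm w)^-1 *: w.
have uE' : u *m E'^T = 0 by rewrite -scalemxAl wE' scaler0.
rewrite -[n.+1]/(1 + n)%N.
exists (col_mx u E'); split.
  rewrite tr_col_mx mul_col_row EE' uE'.
  have -> : E' *m u^T = 0.
    by apply: trmx_inj; rewrite trmx_mul trmxK trmx0.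
  have -> : u *m u^T = 1%:M.
    apply/matrixP => i j; rewrite !ord1 -/(dot u u) /u dotZl dotZr -sqr_enorm !mxE eqxx/=.
    by field.
  by rewrite -scalar_mx_block.
have xw : x = enorm w *: u + x *m E'^T *m E'.
  by rewrite /u scalerA mulfV// scale1r /w /res subrK.
move=> v; rewrite -VX span_cons; split.
  move=> /memv_addP[v1 /vlineP[a ->] [v2 /E'V[c ->] ->]].
  exists (row_mx (a * enorm w)%:M (a *: (x *m E'^T) + c)).
  rewrite mul_row_col mul_scalar_mx mulmxDl addrA -scalemxAl -scalerA -scalerDr.
  by rewrite -xw.
move=> [c ->].
rewrite -[c]hsubmxK mul_row_col.
have -> : lsubmx c *m u = (lsubmx c 0 0 / enorm w) *: (x - x *m E'^T *m E').
  rewrite -/(res E' x) -/w -scalerA -/u [lsubmx c]mx11_scalar mul_scalar_mx.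
  by rewrite !mxE eqxx mulr1n.
rewrite scalerBr -addrA memv_add ?memvZ ?memv_line//.
by apply/E'V; eexists; rewrite scalemxAl -mulNmx -mulmxDl.
Qed.

(** * Tilt between planes *)

Section Tilt.
Variables (n d : nat).
Hypothesis n0 : (0 < n)%N.

Let nR : (n%:R : R) != 0. Proof. by rewrite pnatr_eq0 -lt0n. Qed.
Let nR0 : 0 < (n%:R : R). Proof. by rewrite ltr0n. Qed.

(** For small [k1], the projections of the rows of [P] to the first plane span it with controlled
    coefficients, and each has residual at most [k1 + k2] against the second plane. That case would
    give 2 in place of 8; the 8 makes the case of large [k1] trivial. *)
Lemma plane_tilt (E1 E2 F P : 'M[R]_(n, d)) (k1 k2 : R) (c : 'rV[R]_n) :
  E1 *m E1^T = 1%:M -> E2 *m E2^T = 1%:M -> F *m F^T = 1%:M ->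
  (forall a, enorm (row a P - row a F) <= (8 * n%:R)^-1) ->
  (forall a, enorm (res E1 (row a P)) <= k1) ->
  (forall a, enorm (res E2 (row a P)) <= k2) ->
  enorm (res E2 (c *m E1)) <= 8 * n%:R * (k1 + k2) * enorm c.
Proof.
move=> EE1 EE2 FF PF P1 P2.
have c0 := enorm_ge0 c.
have k10 : 0 <= k1 := le_trans (enorm_ge0 _) (P1 (Ordinal n0)).
have k20 : 0 <= k2 := le_trans (enorm_ge0 _) (P2 (Ordinal n0)).
(* For large [k1] the bound is trivial; otherwise the projections of the rows of
   [P] to the row space of [E1] still form a well-conditioned basis of it. *)
have [k1_small|k1_big] := leP k1 (8 * n%:R)^-1; last first.
  apply: le_trans (ler_enorm_res EE2 _) _; rewrite enorm_orthonormal//.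
  rewrite ler_peMl//.
  have : 1 <= 8 * n%:R * k1 by rewrite -ler_pdivrMl ?mulr_gt0// mulr1 ltW.
  by move=> /le_trans; apply; rewrite ler_wpM2l ?lerDl// mulr_ge0// ltW.
pose A := P *m E1^T; pose W := A *m E1.
have PW a : row a P - row a W = res E1 (row a P) by rewrite /W /A !row_mul.
have WF a : enorm (row a (W - F)) <= (4 * n%:R)^-1.
  have -> : row a (W - F) = (row a P - row a F) - (row a P - row a W).
    by rewrite linearB/= [RHS]addrC opprB addrA subrK.
  apply: le_trans (ler_enormD _ _) _; rewrite enormN PW.
  have -> : (4 * n%:R)^-1 = (8 * n%:R)^-1 + (8 * n%:R)^-1 :> R by field.
  by apply: lerD => //; exact: (le_trans (P1 a)).
(* [F] preserves norms and [W - F] shrinks them by 1/4, so [u *m W] keeps at least 3/4 of the norm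
   of [u]. In particular [A] is injective. *)
have lowA u : enorm u <= 2 * enorm (u *m A).
  rewrite -(enorm_orthonormal EE1 (u *m A)) -mulmxA -/W.
  have := ler_enorm_mulmx u WF.
  have -> : n%:R * (4 * n%:R)^-1 = 4^-1 :> R by field.
  have := ler_enormB (u *m F) (u *m F - u *m W).
  rewrite subKr -(opprB (u *m W)) enormN -mulmxBr enorm_orthonormal//.
  by have := enorm_ge0 u; lra.
have uA : A \in unitmx.
  rewrite -row_free_unit -kermx_eq0; apply/rowV0P => v /sub_kermxP vA.
  apply: enorm_eq0; apply/eqP; rewrite eq_le enorm_ge0 andbT.
  by have := lowA v; rewrite vA enorm0 mulr0.
pose u := c *m invmx A.
have cu : c *m E1 = u *m W by rewrite /W mulmxA /u mulmxKV.
have uc : enorm u <= 2 * enorm c by have := lowA u; rewrite /u mulmxKV.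
have resW a : enorm (res E2 (row a W)) <= k1 + k2.
  rewrite -[row a W](subKr (row a P)) PW resB addrC.
  apply: le_trans (ler_enormD _ _) _; rewrite enormN; apply: lerD => //.
  by apply: le_trans (ler_enorm_res EE2 _) _; exact: P1.
pose W2 := W - W *m E2^T *m E2.
have -> : res E2 (c *m E1) = u *m W2 by rewrite cu /res /W2 mulmxBr !mulmxA.
have W2k a : enorm (row a W2) <= k1 + k2.
  by have := resW a; rewrite /W2 linearB/= /res !row_mul.
apply: le_trans (ler_enorm_mulmx u W2k) _.
have nk : 0 <= n%:R * (k1 + k2) by rewrite mulr_ge0 ?addr_ge0// ltW.
have := ler_wpM2l nk uc.
by have := mulr_ge0 nk c0; nra.
Qed.

(** Translating [y] to the origin and dilating by [2 / s] turns the points [p a] into rows within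
    $1/(8n)$ of those of [F]. *)
Lemma plane_tilt_scale (E1 E2 F : 'M[R]_(n, d)) (y : 'rV[R]_d)
    (p : 'I_n -> 'rV[R]_d) (s h1 h2 : R) (c : 'rV[R]_n) :
  0 < s ->
  E1 *m E1^T = 1%:M -> E2 *m E2^T = 1%:M -> F *m F^T = 1%:M ->
  (forall a, enorm (p a - y - (s / 2) *: row a F) <= s / (16 * n%:R)) ->
  (forall a, enorm (res E1 (p a - y)) <= h1) ->
  (forall a, enorm (res E2 (p a - y)) <= h2) ->
  enorm (res E2 (c *m E1)) <= 16 * n%:R * ((h1 + h2) / s) * enorm c.
Proof.
move=> s0 EE1 EE2 FF pF p1 p2.
have s2 : 0 < 2 / s by rewrite divr_gt0.
pose P := \matrix_a ((2 / s) *: (p a - y)).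
have := @plane_tilt E1 E2 F P (2 / s * h1) (2 / s * h2) c EE1 EE2 FF.
have -> : 8 * n%:R * (2 / s * h1 + 2 / s * h2) = 16 * n%:R * ((h1 + h2) / s).
  by field; rewrite gt_eqF.
apply=> a; rewrite rowK.
- have -> : (2 / s) *: (p a - y) - row a F =
      (2 / s) *: (p a - y - (s / 2) *: row a F).
    rewrite [RHS]scalerBr scalerA; congr (_ - _).
    by rewrite (_ : 2 / s * (s / 2) = 1) ?scale1r//; field; rewrite gt_eqF.
  rewrite enormZ gtr0_norm//; apply: le_trans (ler_wpM2l (ltW s2) (pF a)) _.
  by rewrite le_eqVlt; apply/orP; left; apply/eqP; field; rewrite nR gt_eqF.
- by rewrite resZ enormZ gtr0_norm// ler_pM2l.
- by rewrite resZ enormZ gtr0_norm// ler_pM2l.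
Qed.

End Tilt.

(* [256] is a fixed point of the recursion [T = 3/4 T + 64] for the accumulated
   tilt; the extra [1] is for the distance to the plane at the final scale. *)
Definition tilt_const n : R := 257 * n%:R.

Lemma tilt_const_gt0 n : (0 < n)%N -> 0 < tilt_const n.
Proof. by move=> n0; rewrite /tilt_const -natrM ltr0n muln_gt0. Qed.

(** * Accumulation of tilt over dyadic scales *)

Section Multiscale.
Variables (n d : nat) (S : set 'rV[R]_d) (r0 M : R).
Hypotheses (n0 : (0 < n)%N) (r0_gt0 : 0 < r0) (M_gt0 : 0 < M).

(** In the application [r0] is $2^{2-i}$, so [r 2] is the radius in $\mathsf{b}_i$, and two points
    of such a ball are less than [r 1] apart. *)
Let r l : R := r0 / 2 ^+ l.
Let t l : R := M * (4 / 3) ^+ l.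

(** A witness for [beta]: the plane through [y] is recorded by an orthonormal basis of its
    direction, and the height [h] is not divided by the radius [s]. *)
Definition adapted (y : 'rV[R]_d) (s h : R) (E : 'M[R]_(n, d)) :=
  E *m E^T = 1%:M /\
  forall z, S z -> enorm (z - y) < s -> enorm (res E (z - y)) <= h.

Hypothesis Hbeta : forall l y, S y -> enorm y < 1 ->
  exists E, adapted y (r l) (t l * r l) E.
Hypothesis Halpha : forall l y, S y -> enorm y < 1 ->
  exists (F : 'M[R]_(n, d)) (p : 'I_n -> 'rV[R]_d), F *m F^T = 1%:M /\
    forall a, [/\ S (p a), enorm (p a - y) < r l &
      enorm (p a - y - (r l / 2) *: row a F) <= r l / (16 * n%:R)].

Let r_gt0 l : 0 < r l. Proof. by rewrite divr_gt0// exprn_gt0. Qed.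
Let t_gt0 l : 0 < t l. Proof. by rewrite mulr_gt0// exprn_gt0. Qed.
Let rS l : r l = 2 * r l.+1.
Proof. by rewrite /r exprS; field; rewrite expf_neq0. Qed.
Let tS l : t l.+1 = 4 / 3 * t l. Proof. by rewrite /t exprS; ring. Qed.

(** The frame points that [Halpha] gives at [y] are within [r l] of [x], so both planes pass close
    to them. Against [E'], [p a - y] is a difference of two vectors based at [x], whence twice the
    height. *)
Lemma tilt_step l x y E E' (c : 'rV[R]_n) :
  S y -> enorm y < 1 -> enorm (y - x) < r l.+1 ->
  adapted y (r l.+1) (t l.+1 * r l.+1) E -> adapted x (r l) (t l * r l) E' ->
  enorm (res E' (c *m E)) <= 64 * n%:R * t l.+1 * enorm c.
Proof.
move=> Sy y1 yx [EE Ey] [EE' Ex].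
have [F [p [FF Fp]]] := Halpha l.+1 Sy y1.
have := @plane_tilt_scale n d n0 E E' F y p (r l.+1) (t l.+1 * r l.+1)
  (2 * (t l * r l)) c (r_gt0 _) EE EE' FF.
(* As $r_l=2r_{l+1}$ and $t_l=\frac34 t_{l+1}$, the quotient is $4t_{l+1}$: one part from [E] and
   three from [E']. *)
have -> : 16 * n%:R * ((t l.+1 * r l.+1 + 2 * (t l * r l)) / r l.+1) =
    64 * n%:R * t l.+1.
  by rewrite (rS l) (tS l); field; rewrite gt_eqF.
apply=> a; have [Sp py pF] := Fp a => //; first exact: Ey.
have -> : p a - y = (p a - x) - (y - x) by rewrite opprB addrA subrK.
rewrite resB; apply: le_trans (ler_enormD _ _) _; rewrite enormN.
have -> : 2 * (t l * r l) = t l * r l + t l * r l by ring.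
apply: lerD; apply: Ex => //; last first.
  by rewrite (lt_trans yx)// (rS l) ltr_pMl// ltr1n.
have -> : p a - x = (p a - y) + (y - x) by rewrite addrA subrK.
by apply: le_lt_trans (ler_enormD _ _) _; rewrite (rS l); lra.
Qed.

(** Only the base case moves the centre from [x] to [y]; the later steps refine the scale at [y]. As
    [t] grows geometrically, the sum of the tilts is comparable to its last term. *)
Lemma tilt_multiscale l x y E0 E (c : 'rV[R]_n) :
  S y -> enorm y < 1 -> enorm (y - x) < r 1 ->
  adapted x (r 0) (t 0 * r 0) E0 -> adapted y (r l.+1) (t l.+1 * r l.+1) E ->
  enorm (res E0 (c *m E)) <= 256 * n%:R * t l.+1 * enorm c.
Proof.
move=> Sy y1 yx E0x; elim: l E c => [|l IH] E c Ey.
  apply: le_trans (tilt_step c Sy y1 yx Ey E0x) _.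
  rewrite ler_wpM2r ?enorm_ge0// ler_wpM2r ?(ltW (t_gt0 _))//.
  by rewrite ler_wpM2r// ler_nat.
have [E' Ey'] := Hbeta l.+1 Sy y1.
have [EE' _] := Ey'; have [EE _] := Ey.
(* The component orthogonal to the intermediate plane is the new tilt; the component inside it goes
   to the induction hypothesis. *)
have -> : c *m E = res E' (c *m E) + c *m E *m E'^T *m E' by rewrite subrK.
rewrite resD; apply: le_trans (ler_enormD _ _) _.
have yy : enorm (y - y) < r l.+2 by rewrite subrr enorm0.
have h1 := tilt_step c Sy y1 yy Ey Ey'.
have h2 := IH E' (c *m E *m E'^T) Ey'.
have h3 : enorm (c *m E *m E'^T) <= enorm c.
  by rewrite -[leRHS](enorm_orthonormal EE) ler_enorm_proj.
have h4 := ler_enorm_res E0x.1 (res E' (c *m E)).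
have h5 : 256 * n%:R * t l.+1 * enorm (c *m E *m E'^T) <=
    256 * n%:R * t l.+1 * enorm c.
  apply: ler_wpM2l h3.
  exact: mulr_ge0 (mulr_ge0 (ler0n _ _) (ler0n _ _)) (ltW (t_gt0 _)).
apply: le_trans (lerD (le_trans h4 h1) (le_trans h2 h5)) _.
by rewrite (tS l.+1) le_eqVlt; apply/orP; left; apply/eqP; field.
Qed.

(** The least [l] with [r l.+1 <= 2 * D] works: [r l.+1 <= D] would give [r l <= 2 * D] against
    minimality or, for [l = 0], contradict [D < r 1]. *)
Lemma dyadic_scale (D : R) : 0 < D -> D < r 1 ->
  exists l, D < r l.+1 /\ r l.+1 <= 2 * D.
Proof.
move=> D0 D1.
have [l0 Dl0] : exists l, r l.+1 <= 2 * D.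
  have [k hk] : exists k : nat, r0 / (2 * D) < k%:R.
    exists (Num.bound (r0 / (2 * D))); apply: archi_boundP.
    by rewrite divr_ge0 ?mulr_ge0 ?ltW.
  exists k; rewrite /r ler_pdivrMr ?exprn_gt0//.
  rewrite -ler_pdivrMl ?mulr_gt0// mulrC; apply: (le_trans (ltW hk)).
  by rewrite -natrX ler_nat ltnW// (leq_trans (ltn_expl k (leqnn 2)))// leq_pexp2l.
have [l Pl minl] := ex_minnP (ex_intro (fun l => r l.+1 <= 2 * D) l0 Dl0).
exists l; split=> //; case: l Pl minl => [//|l] Pl minl.
rewrite ltNge; apply/negP => lD.
have := minl l; rewrite ltnn => h; suff // : false by [].
by apply: h; rewrite (rS l.+1) ler_pM2l.
Qed.

(** The distortion of a pair is estimated at the scale of its own distance, through the plane of [y]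
    at that scale and its tilt against the plane of [x]. The last hypothesis keeps [y] in the unit
    ball, where such planes are available. *)
Lemma proj_almost_isometry x : S x -> enorm x < 1 ->
  (forall y, S y -> enorm (y - x) < r 2 -> enorm y < 1) ->
  exists E : 'M[R]_(n, d), E *m E^T = 1%:M /\
  forall y z, S y -> S z -> enorm (y - x) < r 2 -> enorm (z - x) < r 2 ->
    `|enorm ((z - y) *m E^T) - enorm (z - y)| <= 2 * tilt_const n ^+ 2 * M ^+ 2 * r0.
Proof.
move=> Sx x1 B1; have [E0 E0x] := Hbeta 0 Sx x1.
have EE0 := E0x.1; exists E0; split=> // y z Sy Sz yx zx.
rewrite distrC ger0_norm ?subr_ge0 ?ler_enorm_proj//.
set K := (X in _ <= X).
have C0 := ltW (tilt_const_gt0 n0).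
have K0 : 0 <= K.
  exact: mulr_ge0 (mulr_ge0 (mulr_ge0 (ler0n _ 2) (sqr_ge0 _)) (sqr_ge0 _)) (ltW r0_gt0).
(* Coincident points have no dyadic scale and are treated apart. *)
have := enorm_ge0 (z - y); rewrite le_eqVlt => /predU1P[<-|zy0].
  by rewrite sub0r (le_trans _ K0)// oppr_le0 enorm_ge0.
have zyr1 : enorm (z - y) < r 1.
  have -> : z - y = (z - x) - (y - x) by rewrite opprB addrA subrK.
  by apply: le_lt_trans (ler_enormD _ _) _; rewrite enormN (rS 1); lra.
have [l [Dl lD]] := dyadic_scale zy0 zyr1.
have y1 := B1 y Sy yx.
have [E Ey] := Hbeta l.+1 Sy y1.
have yx1 : enorm (y - x) < r 1 by have := r_gt0 2; rewrite (rS 1); lra.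
have h1 := tilt_multiscale ((z - y) *m E^T) Sy y1 yx1 E0x Ey.
have h2 := Ey.2 z Sz Dl.
have h3 := ler_enorm_proj Ey.1 (z - y).
have T0 := ltW (t_gt0 l.+1).
have n1 : 1 <= n%:R :> R by rewrite ler1n.
have hres : enorm (res E0 (z - y)) <= tilt_const n * t l.+1 * r l.+1.
  have -> : z - y = res E (z - y) + (z - y) *m E^T *m E by rewrite subrK.
  rewrite resD; apply: le_trans (ler_enormD _ _) _.
  have h4 := le_trans (ler_enorm_res EE0 (res E (z - y))) h2.
  apply: le_trans (lerD h4 h1) _.
  have : 256 * n%:R * t l.+1 * enorm ((z - y) *m E^T) <= 256 * n%:R * t l.+1 * r l.+1.
    apply: ler_wpM2l; last exact: le_trans h3 (ltW Dl).
    exact: mulr_ge0 (mulr_ge0 (ler0n _ _) (ler0n _ _)) T0.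
  have : t l.+1 * r l.+1 <= n%:R * (t l.+1 * r l.+1) by rewrite ler_peMl// mulr_ge0// ltW.
  by rewrite /tilt_const; lra.
have := proj_defect EE0 (z - y).
set D := enorm (z - y) in zy0 Dl lD h3 *; set D' := enorm _.
have hres2 : enorm (res E0 (z - y)) ^+ 2 <= (tilt_const n * t l.+1 * r l.+1) ^+ 2.
  apply: lerXn2r hres; rewrite nnegrE ?enorm_ge0//.
  exact: mulr_ge0 (mulr_ge0 C0 T0) (ltW (r_gt0 _)).
have tr : t l.+1 ^+ 2 * r l.+1 <= M ^+ 2 * r0.
  have -> : t l.+1 ^+ 2 * r l.+1 = M ^+ 2 * r0 * (8 / 9) ^+ l.+1.
    have -> : 8 / 9 = (4 / 3) * (4 / 3) / 2 :> R by field.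
    rewrite /t /r (exprMn_comm _ (mulrC (4 / 3 * (4 / 3)) 2^-1)).
    rewrite (exprMn_comm _ (mulrC (4 / 3) (4 / 3))) exprVn.
    by move: ((4 / 3) ^+ l.+1) ((2 ^+ l.+1)^-1) => a b; ring.
  apply: ler_piMr; first by apply: mulr_ge0; [exact: sqr_ge0 | exact: ltW].
  by apply: exprn_ile1; lra.
move=> /le_trans/(_ hres2) h.
have D'D : D' <= D by exact: ler_enorm_proj.
(* The bound [r l.+1 <= 2 * D] replaces a division by [D] in the defect estimate; hence the factor 2
   in [K]. *)
have h6 : r l.+1 * (D - D') <= r l.+1 * K.
  have : r l.+1 * (D - D') <= 2 * D * (D - D') by rewrite ler_wpM2r ?subr_ge0.
  move=> /le_trans; apply.
  have -> : r l.+1 * K = 2 * tilt_const n ^+ 2 * r l.+1 * (M ^+ 2 * r0).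
    by rewrite /K; ring.
  have q0 : 0 <= 2 * tilt_const n ^+ 2 * r l.+1.
    exact: mulr_ge0 (mulr_ge0 (ler0n _ 2) (sqr_ge0 _)) (ltW (r_gt0 _)).
  apply: le_trans (ler_wpM2l q0 tr).
  have -> : 2 * tilt_const n ^+ 2 * r l.+1 * (t l.+1 ^+ 2 * r l.+1) =
      2 * (tilt_const n * t l.+1 * r l.+1) ^+ 2 by ring.
  by rewrite -mulrA ler_pM2l.
by move: h6; rewrite ler_pM2l.
Qed.

End Multiscale.

(** * From the numbers alpha and beta to the map *)

Section Flatness.
Variables (n d : nat) (S : set 'rV[R]_d).

Lemma affine_planeP (G : set 'rV[R]_d) (x : 'rV[R]_d) :
  affine_plane n G -> G x ->
  exists E : 'M[R]_(n, d), E *m E^T = 1%:M /\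
    forall y, G y <-> exists c, y = x + c *m E.
Proof.
move=> [p [V [dimV ->]]] [u /= uV <-].
have [E [EE EV]] := orthonormal_basis dimV.
exists E; split=> // y; split=> [[v /= vV <-]|[c ->]].
  have /EV[c vc] : v - u \in V by rewrite memvB.
  by exists c; rewrite -vc -addrA [u + _]addrC subrK.
exists (u + c *m E); last by rewrite addrA.
by rewrite /= memvD//; apply/EV; exists c.
Qed.

Lemma eucl_ballE (x : 'rV[R]_d) r : eucl_ball x r = [set y | enorm (y - x) < r].
Proof. by apply/seteqP; split=> y; rewrite /eucl_ball/= eucl_distE -enormN opprB. Qed.

Lemma adapted_beta x s t : 0 < s -> (beta n S x s < t%:E)%E ->
  exists E : 'M[R]_(n, d), adapted S x s (t * s) E.
Proof.
move=> s0; rewrite /beta lte_pdivrMl// => /ereal_inf_lt[_ [G [Gp Gx] <-]] supG.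
have [E [EE GE]] := affine_planeP Gp Gx.
exists E; split=> // z Sz zx.
have : (dist_to G z < (s * t)%:E)%E.
  apply: le_lt_trans supG; apply: ereal_sup_ubound; exists z => //.
  by rewrite eucl_ballE.
move=> /ereal_inf_lt[_ [g /GE[c ->] <-]]; rewrite lte_fin eucl_distE mulrC => h.
apply: ltW; apply: le_lt_trans h.
by rewrite opprD addrA ler_res_dist.
Qed.

(** The points [x + (s / 2) *: row a F] belong to the plane and, thanks to the half radius, to the
    open ball, so the Hausdorff distance puts a point of [S] near each of them. *)
Lemma frame_alpha x s t : 0 < s -> (alpha n S x s < t%:E)%E ->
  exists (F : 'M[R]_(n, d)) (p : 'I_n -> 'rV[R]_d), F *m F^T = 1%:M /\
    forall a, [/\ S (p a), enorm (p a - x) < s &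
      enorm (p a - x - (s / 2) *: row a F) <= t * s].
Proof.
move=> s0; rewrite /alpha lte_pdivrMl// => /ereal_inf_lt[_ [G [Gp Gx] <-]].
rewrite /hausdorff_dist gt_max => /andP[_ supG].
have [F [FF GF]] := affine_planeP Gp Gx.
suff /choice[p pP] : forall a, exists q, [/\ S q, enorm (q - x) < s &
    enorm (q - x - (s / 2) *: row a F) <= t * s] by exists F, p.
move=> a; pose b := x + (s / 2) *: row a F.
have rowF : enorm (row a F) = 1.
  by rewrite rowE enorm_orthonormal// /enorm dotE (bigD1 a)//= big1 ?addr0 => [|i ia];
    rewrite !mxE eqxx/= ?eqxx ?mulr1 ?sqrtr1// (negbTE ia) mulr0.
have : (dist_to (S `&` eucl_ball x s) b < (s * t)%:E)%E.
  apply: le_lt_trans supG; apply: ereal_sup_ubound; exists b => //; split.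
    by apply/GF; exists ((s / 2) *: delta_mx 0 a); rewrite -scalemxAl -rowE.
  rewrite eucl_ballE/= /b addrAC subrr add0r enormZ rowF mulr1 gtr0_norm ?divr_gt0//.
  by lra.
move=> /ereal_inf_lt[w [q [Sq]]]; rewrite eucl_ballE => qx <- {w}.
rewrite lte_fin eucl_distE mulrC -enormN opprB => /ltW qb.
by exists q; split=> //; rewrite -addrA -opprD.
Qed.

End Flatness.

(** The 16 is 2 from the distortion bound, times 4 from [r0 = 4 * r], times 2 for the strict
    inequality in a $\delta$-isometry. *)
Definition bnum_const n : R := 16 * tilt_const n ^+ 2.

Lemma bnum_const_gt0 n : (0 < n)%N -> 0 < bnum_const n.
Proof. by move=> n0; rewrite mulr_gt0// exprn_gt0// tilt_const_gt0. Qed.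

Lemma bnum_le n d (S : set 'rV[R]_d) (eps M : R) (i : int) :
  (0 < n)%N -> 0 < M -> (2 : R) ^ (- i) < eps ->
  (forall l : nat, alpha_ n S (i - 2 + l%:Z)%R <= ((32 * n%:R)^-1)%:E)%E ->
  (forall l : nat, beta_ n S (i - 2 + l%:Z)%R < (M * (4 / 3) ^+ l)%:E)%E ->
  (bnum_ n S eps i <= (bnum_const n * M ^+ 2)%:E)%E.
Proof.
move=> n0 M0 ieps Ha Hb.
have nR0 : 0 < n%:R :> R by rewrite ltr0n.
set r : R := 2 ^ (- i) in ieps.
have r0 : 0 < r by rewrite exprz_gt0.
have rl l : (2 : R) ^ (- (i - 2 + l%:Z)) = 4 * r / 2 ^+ l.
  have -> : - (i - 2 + l%:Z) = - i + 2%:Z + - l%:Z by rewrite !opprD opprK.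
  rewrite !expfzDr// -/r -exprnN (_ : 2 ^ 2%:Z = 4 :> R); last by rewrite -exprnP; ring.
  by rewrite (mulrC r).
apply: ge_ereal_sup => w [->|[x [Sx]]].
  by rewrite lee_fin mulr_ge0 ?sqr_ge0 ?ltW ?bnum_const_gt0.
rewrite eucl_ballE/= subr0 => x1 <- {w}.
have Hbeta l y : S y -> enorm y < 1 ->
    exists E : 'M[R]_(n, d),
      adapted S y (4 * r / 2 ^+ l) (M * (4 / 3) ^+ l * (4 * r / 2 ^+ l)) E.
  move=> Sy y1; apply: adapted_beta; first by rewrite divr_gt0 ?mulr_gt0 ?exprn_gt0.
  apply: le_lt_trans (Hb l); apply: ereal_sup_ubound; right; exists y.
    by split=> //; rewrite eucl_ballE/= subr0.
  by rewrite rl.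
have Halpha l y : S y -> enorm y < 1 ->
  exists (F : 'M[R]_(n, d)) (p : 'I_n -> 'rV[R]_d), F *m F^T = 1%:M /\
    forall a, [/\ S (p a), enorm (p a - y) < 4 * r / 2 ^+ l &
      enorm (p a - y - (4 * r / 2 ^+ l / 2) *: row a F) <= 4 * r / 2 ^+ l / (16 * n%:R)].
  move=> Sy y1; rewrite [_ / (16 * _)]mulrC.
  apply: frame_alpha; first by rewrite divr_gt0 ?mulr_gt0 ?exprn_gt0.
  (* The bound on [alpha_] is not strict, so it is set at half of the $1/(16n)$ needed for the
     frame. *)
  apply: (@le_lt_trans _ _ ((32 * n%:R)^-1)%:E); last first.
    by rewrite lte_fin ltf_pV2 ?posrE ?mulr_gt0// ltr_pM2r// ltr_nat.
  apply: le_trans (Ha l); apply: ereal_sup_ubound; right; exists y.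
    by split=> //; rewrite eucl_ballE/= subr0.
  by rewrite rl.
have r2 : 4 * r / 2 ^+ 2 = r by field.
have x11 : enorm x < 1 by lra.
(* Here $2^{-i}<\varepsilon$ enters: a ball of that radius centred in $B_{1-\varepsilon}(0)$ stays
   in the unit ball. *)
have inB y : S y -> enorm (y - x) < 4 * r / 2 ^+ 2 -> enorm y < 1.
  rewrite r2 => _ yx; rewrite -(subrK x y).
  by apply: le_lt_trans (ler_enormD _ _) _; lra.
have r40 : 0 < 4 * r by rewrite mulr_gt0.
have [E [EE HE]] := proj_almost_isometry n0 r40 M0 Hbeta Halpha Sx x11 inB.
rewrite r2 in HE.
rewrite /bnum -/r lee_pdivrMl// -EFinM; apply: ereal_inf_lbound.
exists (r * (bnum_const n * M ^+ 2)) => //; split.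
  exact: mulr_gt0 r0 (mulr_gt0 (bnum_const_gt0 n0) (exprn_gt0 2 M0)).
exists (fun y => (y - x) *m E^T); split=> [y [Sy]|y z [Sy] + [Sz]].
  rewrite !eucl_ballE/= subr0; exact/le_lt_trans/ler_enorm_proj.
rewrite !eucl_ballE !eucl_distE/= => yx zx.
have -> : (y - x) *m E^T - (z - x) *m E^T = (y - z) *m E^T.
  by rewrite -mulmxBl opprB addrA subrK.
apply: le_lt_trans (HE z y Sz Sy zx yx) _.
have -> : r * (bnum_const n * M ^+ 2) = 2 * (2 * tilt_const n ^+ 2 * M ^+ 2 * (4 * r)).
  by rewrite /bnum_const; ring.
have q0 : 0 < 2 * tilt_const n ^+ 2 * M ^+ 2 * (4 * r).
  exact: mulr_gt0 (mulr_gt0 (mulr_gt0 (ltr0Sn _ 1)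
    (exprn_gt0 2 (tilt_const_gt0 n0))) (exprn_gt0 2 M0)) r40.
by rewrite (ltr_pMl _ q0) ltr1n.
Qed.

(** * Summation over scales *)

Lemma nneseries_geometric (z : R) : 0 < z < 1 ->
  (\sum_(0 <= l <oo) (z ^+ l)%:E <= ((1 - z)^-1)%:E)%E.
Proof.
move=> /andP[z0 z1]; apply: lime_le.
  by apply: is_cvg_nneseries => l _ _; rewrite lee_fin exprn_ge0// ltW.
near=> k; rewrite sumEFin lee_fin.
have := @geometric_le_lim R k 1 z ler01 z0 ltac:(by rewrite gtr0_norm).
rewrite div1r; apply: le_trans.
by rewrite /series/= ler_sum// => l _; rewrite mul1r.
Unshelve. all: by end_near. Qed.

Lemma nneseries_geometric_scale (z : R) (x : \bar R) : 0 < z < 1 -> (0 <= x)%E ->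
  (\sum_(0 <= l <oo) (z ^+ l)%:E * x <= ((1 - z)^-1)%:E * x)%E.
Proof.
move=> /[dup] z01 /andP[z0 z1]; case: x => [x|_|//]; last first.
  by rewrite gt0_muley ?leey// lte_fin invr_gt0 subr_gt0.
rewrite lee_fin => x0; under eq_eseriesr do rewrite muleC.
rewrite nneseriesZl; last by move=> l _; rewrite lee_fin exprn_ge0// ltW.
by rewrite [leRHS]muleC lee_wpmul2l ?lee_fin// nneseries_geometric.
Qed.

(** After exchanging sums, for fixed [l] the shift [i - k + l] is injective and maps $i\ge i_0$ into
    $i\ge i_0-k$, so the inner sum is at most the full sum of [b]. The weights add up to
    $1/(1-z)$. *)
Lemma esum_le_convolution (a b : int -> \bar R) (z K : R) (i0 k : int) :
  0 < z < 1 -> 0 <= K -> (forall i, 0 <= b i)%E ->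
  (forall i, i0 <= i ->
     (a i <= K%:E * \sum_(0 <= l <oo) (z ^+ l)%:E * b (i - k + l%:Z)%R)%E) ->
  (\esum_(i in [set i : int | (i0 <= i)%R]) a i <=
   (K / (1 - z))%:E * \esum_(i in [set i : int | (i0 - k <= i)%R]) b i)%E.
Proof.
move=> z01 K0 b0 ab; have [z0 z1] := andP z01; set B := (X in (_ <= _ * X)%E).
have B0 : (0 <= B)%E by exact: esum_ge0.
have zb0 i l : (0 <= (z ^+ l)%:E * b (i - k + l%:Z)%R)%E.
  by rewrite mule_ge0// lee_fin exprn_ge0// ltW// .
(* The left side is a supremum over finite sets [X], so only finite sums are exchanged with the
   series. *)
apply: ge_ereal_sup => _ [X [finX XI] <-].
rewrite fsbig_finite//=.
have XI' i : i \in finmap.enum_fset (fset_set X) -> (i0 <= i)%R.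
  by move=> iX; apply: XI; rewrite -(in_setE X) -(in_fset_set finX).
apply: (@le_trans _ _ (\sum_(i <- finmap.enum_fset (fset_set X))
    K%:E * \sum_(0 <= l <oo) (z ^+ l)%:E * b (i - k + l%:Z)%R)%E).
  rewrite big_seq [leRHS]big_seq; apply: lee_sum => i /XI' ii; exact: ab.
rewrite -ge0_sume_distrr; last by move=> i _; apply: nneseries_ge0.
rewrite EFinM -muleA lee_wpmul2l ?lee_fin//.
rewrite -nneseries_sum//.
apply: (@le_trans _ _ (\sum_(0 <= l <oo) (z ^+ l)%:E * B)%E); last first.
  exact: nneseries_geometric_scale.
apply: lee_nneseries => [l _ _|l _]; first exact: sume_ge0.
rewrite -ge0_sume_distrr//.
apply: lee_wpmul2l; first by rewrite lee_fin exprn_ge0// ltW// .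
have inj : set_inj X (fun i => i - k + l%:Z).
  by move=> i j _ _ /= /addIr /addIr.
apply: esum_ge; exists ((fun i => i - k + l%:Z) @` X).
  split; first exact: finite_image.
  by move=> _ [i /XI/= ii <-]; rewrite -addrA [_ + l%:Z]addrC; lia.
by rewrite fsbig_image// fsbig_finite.
Qed.

Lemma powR_exprn (x p : R) l : 0 <= x -> (x ^+ l) `^ p = (x `^ p) ^+ l.
Proof.
move=> x0; elim: l => [|l IH]; first by rewrite !expr0 powR1.
by rewrite !exprS powRM ?exprn_ge0// IH.
Qed.

(** Every weighted term is at most the sum [s] of the series, so with $t^{2\lambda}=s$ each [M]
    above [t] is admissible. *)
Lemma poweR_quadratic_bound (b : \bar R) (beta : nat -> \bar R) (K lambda : R) :
  0 < lambda -> 0 < K -> (0 <= b)%E -> (forall l, 0 <= beta l)%E ->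
  (forall M, 0 < M -> (forall l, beta l < (M * (4 / 3) ^+ l)%:E)%E ->
     (b <= (K * M ^+ 2)%:E)%E) ->
  (b `^ lambda <= ((4 * K) `^ lambda)%:E *
    \sum_(0 <= l <oo) (((3 / 4) `^ (2 * lambda)) ^+ l)%:E * beta l `^ (2 * lambda)%R)%E.
Proof.
move=> lam0 K0 b0 beta0 bM.
have lam2 : 0 < 2 * lambda by rewrite mulr_gt0.
have lam2n : 2 * lambda != 0 by rewrite gt_eqF.
have K4 : 0 < 4 * K by rewrite mulr_gt0.
have termE l : ((((3 / 4) `^ (2 * lambda)) ^+ l)%:E * beta l `^ (2 * lambda)%R =
    (((3 / 4) ^+ l)%:E * beta l) `^ (2 * lambda)%R)%E.
  rewrite (poweRM (2 * lambda) (_ : 0 <= ((3 / 4) ^+ l)%:E)%E (beta0 l)).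
    by rewrite poweR_EFin powR_exprn.
  by rewrite lee_fin exprn_ge0// divr_ge0.
under eq_eseriesr do rewrite termE.
set s := (X in (_ <= _ * X)%E).
have s0 : (0 <= s)%E by apply: nneseries_ge0 => l _ _; exact: poweR_ge0.
have terms l : ((((3 / 4) ^+ l)%:E * beta l) `^ (2 * lambda)%R <= s)%E.
  apply: le_trans (nneseries_lim_ge l.+1 _); last by move=> *; exact: poweR_ge0.
  rewrite big_nat_recr//= leeDr// sume_ge0// => *; exact: poweR_ge0.
(* An infinite sum makes the bound trivial, since the constant in front is positive. *)
case: s s0 terms => [s|_ _|]//; last by rewrite gt0_muley ?leey// lte_fin powR_gt0.
rewrite lee_fin => s0 terms.
pose t := s `^ (2 * lambda)^-1.
have t0 : 0 <= t by exact: powR_ge0.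
have betat l : (((3 / 4) ^+ l)%:E * beta l <= t%:E)%E.
  have x0 : (0 <= ((3 / 4) ^+ l)%:E * beta l)%E by rewrite mule_ge0// lee_fin exprn_ge0.
  rewrite -[leLHS]poweRe1// -[X in (_ `^ X <= _)%E](mulfV lam2n) poweRrM -poweR_EFin.
  apply: gt0_ler_poweR.
  - by rewrite invr_ge0 ltW.
  - by rewrite in_itv/= poweR_ge0 leey.
  - by rewrite in_itv/= lee_fin s0 leey.
  - exact: terms.
have bt M : t < M -> (b <= (K * M ^+ 2)%:E)%E.
  move=> tM; apply: bM => [|l]; first exact: le_lt_trans tM.
  have -> : M * (4 / 3) ^+ l = ((3 / 4) ^+ l)^-1 * M by rewrite -exprVn invf_div mulrC.
  rewrite EFinM lte_pdivlMl ?exprn_gt0//.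
  by apply: le_lt_trans (betat l) _; rewrite lte_fin.
(* Admissibility needs [M] strictly above [t]: the choice [M = 2 * t] produces the 4, and for
   [t = 0] arbitrarily small positive [M] are used. *)
have b4 : (b <= (4 * K * t ^+ 2)%:E)%E.
  move: t0; rewrite le_eqVlt => /predU1P[t0|t0]; last first.
    have -> : 4 * K * t ^+ 2 = K * (2 * t) ^+ 2 by ring.
    by apply: bt; lra.
  apply/lee_addgt0Pr => e e0; rewrite -t0 expr0n mulr0 add0e.
  have -> : e = K * (Num.sqrt (e / K)) ^+ 2.
    by rewrite sqr_sqrtr ?divr_ge0 ?ltW//; field; rewrite gt_eqF.
  by apply: bt; rewrite -t0 sqrtr_gt0 divr_gt0.
apply: (@le_trans _ _ ((4 * K * t ^+ 2)%:E `^ lambda)%E).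
  apply: gt0_ler_poweR => //; first exact: ltW.
  - by rewrite in_itv/= b0 leey.
  - by rewrite in_itv/= lee_fin leey andbT mulr_ge0 ?sqr_ge0// ltW.
rewrite poweR_EFin powRM ?sqr_ge0 ?(ltW K4)// EFinM.
rewrite (_ : (t ^+ 2) `^ lambda = s)//.
rewrite -(powR_mulrn 2 t0) -!powRrM (_ : _ * _ = 1) ?powRr1//.
by field; rewrite gt_eqF.
Qed.

End Euclidean.

Theorem theorem2 (R : realType) (n : nat) (hn : (0 < n)%N) :
  exists delta : R, 0 < delta /\
  exists C : R -> R, (forall lambda : R, 0 < lambda -> 0 < C lambda) /\
  forall (d : nat) (S : set 'rV[R]_d) (eps : R) (ibar : nat),
    (n < d)%N -> 0 < eps -> eps < 2^-1 ->
    (0 < ibar)%N -> (2 : R) ^ (- ibar%:Z) < eps ->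
    (forall i : int, ibar%:Z - 2 <= i -> (alpha_ n S i <= delta%:E)%E) ->
    forall lambda : R, 0 < lambda ->
      (\esum_(i in [set i : int | (ibar%:Z <= i)%R]) (bnum_ n S eps i `^ lambda)
       <= (C lambda)%:E *
          \esum_(i in [set i : int | (ibar%:Z - 2 <= i)%R])
            (beta_ n S i `^ (2 * lambda)%R))%E.
Proof.
have nR0 : 0 < n%:R :> R by rewrite ltr0n.
have zP (lambda : R) : 0 < lambda -> 0 < (3 / 4 : R) `^ (2 * lambda) < 1.
  move=> lam0; rewrite powR_gt0 ?divr_gt0//=.
  have := @gt0_ltr_powR R (2 * lambda) (mulr_gt0 (ltr0Sn _ 1) lam0) (3 / 4) 1.
  by rewrite powR1; apply; rewrite ?nnegrE; lra.
exists (32 * n%:R)^-1; split; first by rewrite invr_gt0 mulr_gt0.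
(* The numerator comes from bounding a single $\mathsf{b}_i^\lambda$, the denominator from the
   geometric series of ratio $(3/4)^{2\lambda}$. *)
exists (fun lambda => (4 * bnum_const n) `^ lambda / (1 - (3 / 4) `^ (2 * lambda))).
split=> [lambda lam0|d S eps ibar _ _ _ _ ieps Ha lambda lam0].
  have /andP[_ z1] := zP lambda lam0.
  by rewrite divr_gt0 ?subr_gt0// powR_gt0// mulr_gt0// bnum_const_gt0.
apply: esum_le_convolution; [exact: zP|exact: powR_ge0| |].
  by move=> i; exact: poweR_ge0.
move=> i ii.
have sup0 (A : set (\bar R)) : (0 <= sup_ge0 A)%E by apply: ereal_sup_ubound; left.
apply: (@poweR_quadratic_bound _ _ (fun l => beta_ n S (i - 2 + l%:Z))) => //.
- exact: bnum_const_gt0.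
- exact: sup0.
- by move=> l; exact: sup0.
move=> M M0 HM; apply: bnum_le => //.
  by apply: le_lt_trans ieps; rewrite ler_weXz2l ?ler1n// lerN2.
move=> l; apply: Ha; lia.
Qed.
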